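(* Let $D$ be a dataset over items $A=\{a_1,\dots,a_N\}$, let $\mathcal{C}$ be a collection of itemsets and let $p^*$ be the maximum entropy distribution on $\mathcal{T}=\{0,1\}^N$ subject to $p(Y=1)=\mathrm{fr}(Y)$ for all $Y\in\mathcal{C}$. Let $X\notin\mathcal{C}$ be an itemset such that $\mathrm{fr}(X)=p^*(X=1)$. Then $s(\mathcal{C}\cup\{X\},D)>s(\mathcal{C},D)$, where $s$ denotes either the BIC score or the MDL score.
   Context: Transactions are $t\in\{0,1\}^N$; $S_Y(t)=1$ iff $t_i=1$ for all $a_i\in Y$; a dataset $D$ is a finite nonempty multiset of transactions, $\mathrm{fr}(Y)$ is the fraction of its transactions supporting $Y$; for a distribution $p$, $p(Y=1)=\sum_{t:S_Y(t)=1}p(A=t)$. For a collection $\mathcal{C}=(X_1,\dots,X_k)$ (frequencies always taken from $D$), $p^*_{\mathcal{C}}$ is the unique entropy-maximizing distribution on $\{0,1\}^N$ with $p(X_i=1)=\mathrm{fr}(X_i)$ for all $i$, and $\log p^*_{\mathcal{C}}(D)=\sum_{t\in D}\log p^*_{\mathcal{C}}(A=t)$ (logs base 2). $\mathrm{BIC}(\mathcal{C},D)=-\log p^*_{\mathcal{C}}(D)+\frac{k}{2}\log|D|$. With $x=\sum_i|X_i|$, $l_1=\log|D|+N\log(1+N^{-1})+1$, $l_2=\log N$: $\mathrm{MDL}(\mathcal{C},D)=-\log p^*_{\mathcal{C}}(D)+l_1k+l_2x+1$.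
   Formalization: The BIC inequality is stated only for datasets with |D| > 1: when |D| = 1, log|D| = 0, so the BIC penalty vanishes and both scores are equal (e.g. N = 2, D = {(1,1)}, C = {{a1},{a2}}, X = {a1,a2}). The MDL inequality is stated for every nonempty D. *)

(* Defs.v *)
From mathcomp Require Import all_boot all_order all_algebra.
From mathcomp Require Import finmap multiset.
From mathcomp Require Import boolp classical_sets reals exp.

Set Implicit Arguments.
Unset Strict Implicit.
Unset Printing Implicit Defensive.

Import Order.TTheory GRing.Theory Num.Theory.
Local Open Scope ring_scope.

Definition transaction (N : nat) := {ffun 'I_N -> bool}.
Definition itemset (N : nat) := {set 'I_N}.
Notation dataset N := ({mset (transaction N)}%mset).
Definition collection (N : nat) := {set itemset N}.

Definition supports (N : nat) (Y : itemset N) (t : transaction N) : bool :=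
  [forall i in Y, t i].

(* ln is 0 on nonpositive reals, so log2 0 = 0 and p * log2 p follows the
   usual entropy convention 0 * log 0 = 0. *)
Definition log2 (R : realType) (x : R) : R := ln x / ln 2.

(* The multiset D coerces to a sequence listing each transaction with its
   multiplicity, so size D is |D| and sums over D count multiplicities. *)
Definition fr (R : realType) (N : nat) (D : dataset N) (Y : itemset N) : R :=
  (count (supports Y) D)%:R / (size D)%:R.

Definition is_distr (R : realType) (N : nat)
    (p : {ffun transaction N -> R}) : Prop :=
  (forall t, 0 <= p t) /\ \sum_t p t = 1.

Definition prob (R : realType) (N : nat)
    (p : {ffun transaction N -> R}) (Y : itemset N) : R :=
  \sum_(t | supports Y t) p t.

Definition entropy (R : realType) (N : nat)
    (p : {ffun transaction N -> R}) : R :=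
  - \sum_t p t * log2 (p t).

Definition feasible (R : realType) (N : nat) (C : collection N)
    (D : dataset N) (p : {ffun transaction N -> R}) : Prop :=
  is_distr p /\ (forall Y, Y \in C -> prob p Y = fr R D Y).

Definition is_maxent (R : realType) (N : nat) (C : collection N)
    (D : dataset N) (p : {ffun transaction N -> R}) : Prop :=
  feasible C D p /\ (forall q, feasible C D q -> entropy q <= entropy p).

(* For nonempty D exactly one p satisfies is_maxent C D: the feasible set is
   compact, convex and contains the empirical distribution of D, and entropy is
   continuous and strictly concave. The default value is then never used. *)
Definition maxent (R : realType) (N : nat) (C : collection N)
    (D : dataset N) : {ffun transaction N -> R} :=
  xget [ffun=> 0] (is_maxent C D).

(* maxent C D t > 0 for every t in D, so the junk value log2 0 = 0 does not
   occur here. *)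
Definition loglik (R : realType) (N : nat) (C : collection N)
    (D : dataset N) : R :=
  \sum_(t <- D) log2 (maxent R C D t).

Definition BIC (R : realType) (N : nat) (C : collection N)
    (D : dataset N) : R :=
  - loglik R C D + #|C|%:R / 2 * log2 (size D)%:R.

Definition MDL (R : realType) (N : nat) (C : collection N)
    (D : dataset N) : R :=
  let l1 := log2 (size D)%:R + N%:R * log2 (1 + N%:R^-1) + 1 in
  let l2 := log2 N%:R in
  let x := (\sum_(Y in C) #|Y|)%N in
  - loglik R C D + l1 * #|C|%:R + l2 * x%:R + 1.

(* Main.v *)
Require Import Defs.
From mathcomp Require Import all_boot all_order all_algebra.
From mathcomp Require Import finmap multiset.
From mathcomp Require Import boolp classical_sets reals exp.
From mathcomp Require Import topology normedtype derive realfun.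
From mathcomp Require Import lra ring.

(** If fr(X) = p*(X = 1), then p* satisfies the constraints of C ∪ {X}. It still
    maximizes the entropy, since the additional constraint only shrinks the
    feasible set, so by uniqueness it is the maximum entropy distribution of
    C ∪ {X}. Hence the log-likelihoods agree and the scores differ by the
    positive penalty of X. Existence of the maximum comes from compactness of
    the feasible set, uniqueness from strict concavity of -x ln x. *)

Import Order.TTheory GRing.Theory Num.Theory.
Import numFieldNormedType.Exports.
Local Open Scope ring_scope.

(** * Strict convexity and continuity of [x * ln x] *)

Lemma ltr_xlnx_tangent {R : realType} {a m : R} :
  0 <= a -> 0 < m -> a != m -> a * ln m + a - m < a * ln a.
Proof.
rewrite le_eqVlt => /predU1P[<-|a0] m0 am; first by rewrite !mul0r; lra.
have l0 : ln (m / a) != 0.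
  rewrite ln_eq0 ?divr_gt0//; apply: contra am => /eqP/divr1_eq->//.
(* This is [1 + u < expR u] at [u = ln (m / a)], nonzero because [a != m]; multiplying by [a] gives
   the claim. *)
have := expR_gt1Dx l0; rewrite lnK ?posrE ?divr_gt0// ln_div ?posrE//.
rewrite ltr_pdivlMr//; lra.
Qed.

(** Both [a] and [b] lie strictly above the tangent at their midpoint [m]; in the sum of the two
    inequalities the linear terms cancel, since [m + m = a + b]. *)
Lemma xlnx_midpoint_lt {R : realType} {a b : R} :
  0 <= a -> 0 <= b -> a != b ->
  (a + b) / 2 * ln ((a + b) / 2) < (a * ln a + b * ln b) / 2.
Proof.
move=> a0 b0 ab; set m := (a + b) / 2.
have am : a != m by apply: contra_neq ab; rewrite /m; lra.
have bm : b != m by apply: contra_neq ab; rewrite /m; lra.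
have m0 : 0 < m.
  rewrite /m divr_gt0// lt_neqAle addr_ge0// andbT eq_sym paddr_eq0//.
  by apply: contra ab => /andP[/eqP-> /eqP->].
have := ltr_xlnx_tangent a0 m0 am; have := ltr_xlnx_tangent b0 m0 bm.
have -> : m * ln m = (a * ln m + b * ln m) / 2 by rewrite /m; field.
have : m + m = a + b by rewrite /m; field.
lra.
Qed.

(* For x <= 0 both sides are 0, by the junk values of ln and Num.sqrt. *)
Lemma normr_xlnx_le {R : realType} {x : R} : x <= 1 ->
  `|x * ln x| <= 2 * Num.sqrt x.
Proof.
move=> x1; have [x0|x0] := leP x 0.
  by rewrite ln0// mulr0 normr0 mulr_ge0// sqrtr_ge0.
set s := Num.sqrt x; have s0 : 0 < s by rewrite sqrtr_gt0.
have xE : x = s ^+ 2 by rewrite sqr_sqrtr// ltW.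
rewrite ler0_norm; last by rewrite mulr_ge0_le0 ?ln_le0 ?(ltW x0).
have sV0 : 0 < s^-1 by rewrite invr_gt0.
(* With [x = s ^+ 2], the bound [- ln s <= s^-1] leaves a factor [s], which tends to 0 with [x]. *)
have := ltW (ln_sublinear sV0); rewrite lnV ?posrE// => lns.
rewrite xE lnXn//.
have : s ^+ 2 * - ln s <= s ^+ 2 * s^-1 by rewrite ler_pM2l ?exprn_gt0.
have -> : s ^+ 2 * s^-1 = s by field; rewrite gt_eqF.
lra.
Qed.

Local Open Scope classical_set_scope.

Lemma continuous_xlnx {R : realType} : continuous (fun x : R => x * ln x).
Proof.
move=> x; have [x0|x0] := ltP 0 x.
  by apply: cvgM; [exact: cvg_id|exact: continuous_ln].
(* At [x <= 0] the value is 0, and near [x] the function is squeezed between 0 and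
   [2 * Num.sqrt y]. *)
rewrite /continuous_at ln0// mulr0; apply/norm_cvg0P.
apply: (squeeze_cvgr (f := fun=> 0) (h := fun y => 2 * Num.sqrt y)).
- near=> y; rewrite normr_ge0/= normr_xlnx_le//; near: y.
  by apply: lt_le_nbhsl; rewrite (le_lt_trans x0).
- exact: cvg_cst.
- rewrite -[X in _ --> X](mulr0 2) -[X in 2 * X](ler0_sqrtr x0).
  by apply: cvgM; [exact: cvg_cst|exact: sqrt_continuous].
Unshelve. all: by end_near. Qed.

(** * Existence of the maximum entropy distribution *)

Lemma continuous_sum_ptws {R : realType} {T : finType} (P : pred T) (g : R -> R) :
  continuous g ->
  continuous (fun f : {ptws T -> R} => \sum_(t | P t) g (f t)).
Proof.
move=> cg; apply: continuous_big => [|t _]; first exact: add_continuous.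
move=> f; apply: continuous_comp; last exact: cg.
exact: (@proj_continuous T (fun=> R) t).
Qed.

(** The feasible set is closed in the cube of functions with values in [0, 1], which is compact by
    Tychonoff. *)
Lemma feasible_compact {R : realType} {N : nat} (C : collection N)
    (D : dataset N) :
  compact [set f : {ptws transaction N -> R} |
    feasible C D [ffun t => f t]].
Proof.
have cid : continuous (@id R) by move=> x; exact: cvg_id.
set K := [set f | _].
apply: (@subclosed_compact _ _ [set f : {ptws transaction N -> R} |
    forall t, `[0, 1]%classic (f t)]).
(* Each condition is the preimage of a closed set under a coordinate or a finite sum of
   coordinates. *)
- have -> : K = \bigcap_(t in setT) [set f | 0 <= f t]
      `&` [set f | \sum_t f t = 1]
      `&` \bigcap_(Y in [set Y | Y \in C])
           [set f | \sum_(t | supports Y t) f t = fr R D Y].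
    apply/seteqP; split => f /=.
      move=> [[f0 f1] fC]; split; [split|].
      + by move=> t _ /=; have := f0 t; rewrite ffunE.
      + by rewrite -f1; apply: eq_bigr => t _; rewrite ffunE.
      + move=> Y YC /=; rewrite -fC// /prob.
        by apply: eq_bigr => t _; rewrite ffunE.
    move=> [[f0 f1] fC]; split; [split|].
    + by move=> t; rewrite ffunE; exact: f0.
    + by rewrite -f1; apply: eq_bigr => t _; rewrite ffunE.
    + move=> Y YC; rewrite -[RHS]fC//.
      by apply: eq_bigr => t _; rewrite ffunE.
  apply: closedI; [apply: closedI|].
  + apply: closed_bigI => t _.
    apply: (@preimage_closed _ _ (fun f : {ptws transaction N -> R} => f t)
      [set x | 0 <= x]); last exact: closed_ge.
    by move=> f _; exact: (@proj_continuous (transaction N) (fun=> R) t).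
  + apply: (@preimage_closed _ _
      (fun f : {ptws transaction N -> R} => \sum_t f t) [set x | x = 1]);
      last exact: closed_eq.
    by move=> f _; exact: (continuous_sum_ptws predT id cid).
  + apply: closed_bigI => Y _.
    apply: (@preimage_closed _ _
      (fun f : {ptws transaction N -> R} => \sum_(t | supports Y t) f t)
      [set x | x = fr R D Y]); last exact: closed_eq.
    by move=> f _; exact: (continuous_sum_ptws (supports Y) id cid).
- exact: (@tychonoff (transaction N) (fun=> R) (fun=> `[0, 1]%classic)
    (fun=> @segment_compact R 0 1)).
- move=> f [[f0 f1] _] t /=; rewrite in_itv/=.
  have := f0 t; rewrite ffunE => -> /=.
  (* No coordinate exceeds the total mass 1, the other ones being nonnegative. *)
  rewrite -f1 (bigD1 t)//= ffunE lerDl sumr_ge0// => s _; exact: f0.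
Qed.

Lemma sum_count_mem {T : finType} (P : pred T) (s : seq T) :
  (\sum_(t | P t) count_mem t s)%N = count P s.
Proof.
under eq_bigr do rewrite -sum1_count big_mkcond/=.
rewrite exchange_big/= -sum1_count [RHS]big_mkcond/=.
apply: eq_bigr => x _; rewrite -big_mkcondr/=.
case: ifPn => Px; first rewrite (big_pred1 x)// => t /=.
  by rewrite eq_sym; have [->|//] := eqVneq t x; rewrite ?Px ?andbF.
apply: big_pred0 => t; have [<-|] := eqVneq x t; rewrite ?andbF//.
by rewrite (negPf Px).
Qed.

(** The empirical distribution witnesses that the feasible set is nonempty, as the extreme value
    theorem requires. *)
Lemma empirical_feasible {R : realType} {N : nat} (C : collection N)
    {D : dataset N} : D != mset0 ->
  feasible C D [ffun t => (count_mem t D)%:R / (size D)%:R : R].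
Proof.
rewrite -size_mset_eq0 => D0.
have sumE (P : pred (transaction N)) :
    \sum_(t | P t) [ffun t => (count_mem t D)%:R / (size D)%:R : R] t
    = (count P D)%:R / (size D)%:R.
  under eq_bigr do rewrite ffunE.
  by rewrite -mulr_suml -natr_sum sum_count_mem.
split; [split|].
- by move=> t; rewrite ffunE divr_ge0.
- by rewrite sumE count_predT divff// pnatr_eq0.
- by move=> Y _; rewrite /prob sumE.
Qed.

Lemma continuous_entropy {R : realType} {N : nat} :
  continuous (fun f : {ptws transaction N -> R} => entropy [ffun t => f t]).
Proof.
have cl : continuous (fun x : R => x * log2 x).
  move=> x; rewrite /log2 /continuous_at.
  under eq_cvg do rewrite mulrA.
  by rewrite mulrA; apply: cvgM; [exact: continuous_xlnx|exact: cvg_cst].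
move=> f; rewrite /entropy; apply: continuousN.
have := continuous_sum_ptws predT _ cl f.
congr (continuous_at _ _); apply/funext => g /=.
by apply: eq_bigr => t _; rewrite ffunE.
Qed.

Lemma maxent_ex {R : realType} {N : nat} (C : collection N)
    {D : dataset N} : D != mset0 -> exists p, @is_maxent R N C D p.
Proof.
move=> D0.
have [] := compact_EVT_max (A := [set f : {ptws transaction N -> R} |
    feasible C D [ffun t => f t]]) _ (feasible_compact C D)
  (continuous_subspaceT continuous_entropy).
  have := empirical_feasible (R := R) C D0.
  set q := [ffun _ => _] => fq; exists (fun t => q t) => /=.
  by have -> : [ffun t => q t] = q by apply/ffunP => t; rewrite ffunE.
move=> f; rewrite inE => /= fC fmax; exists [ffun t => f t]; split=> // q qC.
have qE : [ffun t => q t] = q by apply/ffunP => t; rewrite ffunE.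
by have := fmax (fun t => q t); rewrite inE/= qE; apply.
Qed.

(** * Uniqueness of the maximum entropy distribution *)

Lemma feasible_midpoint {R : realType} {N : nat} {C : collection N}
    {D : dataset N} {p q : {ffun transaction N -> R}} :
  feasible C D p -> feasible C D q ->
  feasible C D [ffun t => (p t + q t) / 2].
Proof.
move=> [[p0 p1] pC] [[q0 q1] qC].
have sumE (P : pred (transaction N)) :
    \sum_(t | P t) [ffun t => (p t + q t) / 2] t
    = (\sum_(t | P t) p t + \sum_(t | P t) q t) / 2.
  under eq_bigr do rewrite ffunE.
  by rewrite -mulr_suml big_split.
split; [split|].
- by move=> t; rewrite ffunE divr_ge0// addr_ge0.
- by rewrite sumE p1 q1; field.
- move=> Y YC; rewrite /prob sumE -/(prob p Y) -/(prob q Y) pC// qC//.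
  by field.
Qed.

Lemma entropy_midpoint_lt {R : realType} {N : nat}
    {p q : {ffun transaction N -> R}} :
  (forall t, 0 <= p t) -> (forall t, 0 <= q t) -> p != q ->
  (entropy p + entropy q) / 2 < entropy [ffun t => (p t + q t) / 2].
Proof.
move=> p0 q0 pq.
have [t0 pqt0] : exists t, p t != q t.
  apply/existsP; apply: contraNT pq => /existsPn pq.
  by apply/eqP/ffunP => t; apply/eqP/negPn.
have entropyE (r : {ffun transaction N -> R}) :
    entropy r = - (\sum_t r t * ln (r t)) / ln 2.
  by rewrite /entropy mulNr mulr_suml; under eq_bigr do rewrite mulrA.
have ln2 : 0 < ln 2 :> R by rewrite ln_gt0// ltr1n.
rewrite !entropyE -mulrDl mulrAC ltr_pM2r ?invr_gt0//.
rewrite -opprD mulNr ltrN2 -big_split/= mulr_suml.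
under eq_bigr do rewrite ffunE.
(* The term at [t0], where [p] and [q] differ, gives strictness; the other terms need only the weak
   inequality. *)
rewrite (bigD1 t0)//= [ltRHS](bigD1 t0)//=.
apply: ltr_leD; first exact: xlnx_midpoint_lt.
apply: ler_sum => t _; have [->|pqt] := eqVneq (p t) (q t).
  have -> : (q t + q t) / 2 = q t by field.
  by rewrite le_eqVlt; apply/orP; left; apply/eqP; field.
exact/ltW/xlnx_midpoint_lt.
Qed.

(** The midpoint of two distinct maximizers would be feasible and have larger entropy than their
    common maximum. *)
Lemma is_maxent_inj {R : realType} {N : nat} {C : collection N}
    {D : dataset N} {p q : {ffun transaction N -> R}} :
  is_maxent C D p -> is_maxent C D q -> p = q.
Proof.
move=> [pf pm] [qf qm]; apply/eqP/negPn/negP => pq.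
have := entropy_midpoint_lt pf.1.1 qf.1.1 pq.
have := pm _ (feasible_midpoint pf qf); have := qm _ (feasible_midpoint pf qf).
lra.
Qed.

(** * Adding [X] to the collection and comparing the scores *)

Lemma maxentP {R : realType} {N : nat} (C : collection N)
    {D : dataset N} : D != mset0 -> is_maxent C D (maxent R C D).
Proof. by move=> D0; apply: xgetPex; exact: maxent_ex. Qed.

Lemma maxent_setU1 {R : realType} {N : nat} {D : dataset N}
    {C : collection N} {X : itemset N} : D != mset0 ->
  fr R D X = prob (maxent R C D) X ->
  maxent R (X |: C)%SET D = maxent R C D.
Proof.
move=> D0 hX; apply: (is_maxent_inj (maxentP _ D0)).
have [[pd pC] pm] := maxentP (R := R) C D0.
split; first by split=> // Y; rewrite in_setU1 => /predU1P[->//|]; exact: pC.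
move=> q [qd qC]; apply: pm; split=> // Y YC.
by apply: qC; rewrite in_setU1 YC orbT.
Qed.

Lemma log2_ge0 {R : realType} {x : R} : 1 <= x -> 0 <= log2 x.
Proof. by move=> x1; rewrite divr_ge0// ln_ge0// ler1n. Qed.

Local Close Scope classical_set_scope.

Theorem theorem4p10 (R : realType) (N : nat) (hN : (0 < N)%N)
    (D : dataset N) (hD : D != mset0) (C : collection N) (X : itemset N)
    (hXC : X \notin C) (hX : fr R D X = prob (maxent R C D) X) :
  ((1 < size D)%N -> BIC R (X |: C)%SET D > BIC R C D) /\
  MDL R (X |: C)%SET D > MDL R C D.
Proof.
have L : loglik R (X |: C)%SET D = loglik R C D.
  by rewrite /loglik maxent_setU1.
rewrite /BIC /MDL L cardsU1 hXC big_setU1//= !natrD.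
have D1 : (0 < size D)%N by rewrite lt0n size_mset_eq0.
split=> [D2|].
  (* BIC grows by half of this logarithm, which would vanish for a single transaction. *)
  have : 0 < log2 (size D)%:R :> R.
    by rewrite divr_gt0// ln_gt0// ltr1n.
  lra.
(* MDL grows by [l1 + l2 * #|X|]. All its terms are nonnegative, and the summand 1 of [l1] makes the
   growth strict, even when [size D] is 1 or [X] is empty. *)
have lD : 0 <= log2 (size D)%:R :> R by rewrite log2_ge0// ler1n.
have lN : 0 <= log2 N%:R * #|X|%:R :> R.
  by rewrite mulr_ge0// log2_ge0// ler1n.
have lV : 0 <= N%:R * log2 (1 + N%:R^-1) :> R.
  by rewrite mulr_ge0// log2_ge0// lerDl invr_ge0.
rewrite !mulrDr; lra.
Qed.
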